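(* (a) Let $K$ be a non-archimedean local field with normalized valuation $\mathrm{val}$ and residue field of cardinality $q$, let $d\ge 1$, let $\Lambda$ be a lattice in $K^d$, and let $X$ be a $K^d$-valued random vector with Gaussian distribution $\mathbb{P}_\Lambda$. Let $V=\mathrm{val}(X)=(\mathrm{val}(X_1),\dots,\mathrm{val}(X_d))$ (which lies in $\mathbb{Z}^d$ almost surely). Then the distribution of $V$, i.e. the push-forward of $\mathbb{P}_\Lambda$ under coordinatewise valuation, is given by a tropical polynomial whose coefficients are given by the entropy map of $\Lambda$: for every $v\in\mathbb{Z}^d$, $$-\log_q \mathbb{P}_\Lambda(V\ge v)=\max_{I\subset[d]}\Big(\sum_{i\in I}v_i-h_I(\Lambda)\Big).$$ (b) In the setting of (a), the vector $(h_I(\Lambda))_{I\subset[d]}$ is supermodular: $h_\emptyset(\Lambda)=0$ and $$h_I(\Lambda)+h_J(\Lambda)\le h_{I\cap J}(\Lambda)+h_{I\cup J}(\Lambda)\quad\text{for all } I,J\subset[d].$$ (c) More generally, let $K$ be any field with a non-archimedean valuation $\mathrm{val}:K\to\mathbb{R}\cup\{+\infty\}$ (with value group an arbitrary additive subgroup of $\mathbb{R}$), let $d\ge1$, and let $\Lambda$ be a lattice in $K^d$. Then for each $I\subset[d]$ the quantity $h_I(\Lambda)=\min_{J\subset[d],\,|J|=|I|}\mathrm{val}(\det(A_{I\times J}))$ does not depend on the choice of the representative $A$ of $\Lambda$, and the vector $(h_I(\Lambda))_{I\subset[d]}$ satisfies $h_\emptyset(\Lambda)=0$ and $h_I(\Lambda)+h_J(\Lambda)\le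 h_{I\cap J}(\Lambda)+h_{I\cup J}(\Lambda)$ for all $I,J\subset[d]$.
   Context: Let $K$ be a field with a non-archimedean additive valuation $\mathrm{val}:K\to\mathbb{R}\cup\{+\infty\}$, and let $\mathcal{O}=\{x\in K:\mathrm{val}(x)\ge0\}$ be its valuation ring. Write $[d]=\{1,\dots,d\}$. A lattice in $K^d$ is an $\mathcal{O}$-submodule $\Lambda=A\mathcal{O}^d$ with $A\in \mathrm{GL}_d(K)$, i.e. the $\mathcal{O}$-module generated by a basis of $K^d$; such an $A$ is called a representative of $\Lambda$ and is determined up to right multiplication by $\mathrm{GL}_d(\mathcal{O})$. Entropy map: for $I\subset[d]$ and a representative $A$ of $\Lambda$, $$h_I(\Lambda)=\min_{J\subset[d],\,|J|=|I|}\mathrm{val}(\det(A_{I\times J})),\qquad h_\emptyset(\Lambda)=0,$$ where $A_{I\times J}$ is the submatrix of $A$ with rows indexed by $I$ and columns indexed by $J$. When $K$ is a local field this equals $\mathrm{val}(\det B)$ for $B$ any representative of the lattice $\Lambda_I\subset K^{|I|}$, the image of $\Lambda$ under projection onto the coordinates in $I$. The entropy map is $H(\Lambda)=(h_I(\Lambda))_{I\subset[d]}\in\mathbb{R}^{2^d}$. When $K$ is a non-archimedean local field, $\mathrm{val}$ is normalized so that $\mathrm{val}(K^\times)=\mathbb{Z}$, $q$ is the cardinality of the (finite) residue field, and $\mu$ is the Haar measure on $K$ with $\mu(\mathcal{O})=1$. The (non-degenerate, multivariate) Gaussian measure $\mathbb{P}_\Lambda$ on $K^d$ given by a lattice $\Lambda$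 is the uniform probability measure on $\Lambda$: $\mathbb{P}_\Lambda(B)=\mu^{\otimes d}(\Lambda\cap B)/\mu^{\otimes d}(\Lambda)$ for Borel $B\subset K^d$. For $V,v\in \mathbb{R}^d$, $V\ge v$ means coordinatewise inequality. *)

(* Defs.v *)
From HB Require Import structures.
From mathcomp Require Import all_boot all_order all_algebra.
From mathcomp Require Import all_classical all_reals all_analysis.

Set Implicit Arguments.
Unset Strict Implicit.
Unset Printing Implicit Defensive.

Import Order.TTheory GRing.Theory Num.Theory.

Local Open Scope classical_set_scope.
Local Open Scope ring_scope.
Local Open Scope ereal_scope.

Section Valuation.
Context {R : realType} {K : fieldType}.
Implicit Types val : K -> \bar R.

Definition valuation val : Prop :=
  [/\ forall x, val x != -oo,
      forall x, val x = +oo <-> x = 0%R,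
      forall x y, val (x * y)%R = val x + val y
    & forall x y, mine (val x) (val y) <= val (x + y)%R].

Definition valuation_ring val : set K := [set x | 0 <= val x].

(* The residue field as the set of cosets a + m, a in the valuation ring,
   where m = {x | 0 < val x} is the maximal ideal. *)
Definition residue_field val : set (set K) :=
  [set [set x | 0 < val (x - a)%R] | a in valuation_ring val].

Definition val_complete val : Prop :=
  forall u : nat -> K,
    (forall r : R, exists N, forall m n, (N <= m)%N -> (N <= n)%N ->
       r%:E <= val (u m - u n)%R) ->
    exists l, forall r : R, exists N, forall n, (N <= n)%N ->
      r%:E <= val (u n - l)%R.

(* K is a non-archimedean local field, val its normalized valuation and q the
   cardinality of its residue field. *)
Definition local_field val (q : nat) : Prop :=
  [/\ valuation val,
      [set val x | x in [set x | x != 0%R]]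
        = [set (m%:~R : R)%:E | m in [set: int]],
      val_complete val
    & (residue_field val #= `I_q)%card].

Definition val_open val : set (set K) :=
  [set U | forall x, U x ->
     exists r : R, [set y | r%:E <= val (y - x)%R] `<=` U].

(* Open sets of the product topology of K^d. *)
Definition vec_open val (d : nat) : set (set 'cV[K]_d) :=
  [set U : set 'cV[K]_d | forall x, U x ->
     exists r : R,
       [set y : 'cV[K]_d | forall i, r%:E <= val (y i ord0 - x i ord0)%R]
         `<=` U].

Definition representative val (d : nat) (A : 'M[K]_d) (L : set 'cV[K]_d) :
    Prop :=
  A \in unitmx /\
  L = [set A *m x | x in
        [set x : 'cV[K]_d | forall i, valuation_ring val (x i ord0)]].

Definition lattice val (d : nat) (L : set 'cV[K]_d) : Prop :=
  exists A, representative val A L.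

(* The submatrix with rows I and columns J, in increasing order. It is square
   when #|J| = #|I|, in which case conform_mx only changes its type; it is 0
   otherwise. *)
Definition submx_IJ (d : nat) (A : 'M[K]_d) (I J : {set 'I_d}) : 'M[K]_#|I| :=
  conform_mx 0%R (mxsub (fun i : 'I_#|I| => enum_val i)
                        (fun j : 'I_#|J| => enum_val j) A).

Definition entropy_mx val (d : nat) (A : 'M[K]_d) (I : {set 'I_d}) : \bar R :=
  \big[mine/+oo]_(J : {set 'I_d} | #|J| == #|I|) val (\det (submx_IJ A I J)).

(* The representative is picked by choice; 1 is a dummy value for sets which
   are not lattices. *)
Definition entropy val (d : nat) (L : set 'cV[K]_d) (I : {set 'I_d}) : \bar R :=
  entropy_mx val (xget 1%:M%R [set A | representative val A L]) I.

End Valuation.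

(* K and K^d with their Borel sigma-algebras; HB needs the carrier of a
   measurableType to be pointed, which a fieldType is not by default. *)
Definition pointed_zmod (V : zmodType) : Type := V.
HB.instance Definition _ (V : zmodType) := Choice.on (pointed_zmod V).
HB.instance Definition _ (V : zmodType) :=
  isPointed.Build (pointed_zmod V) (0 : V)%R.

Notation borelK val :=
  (@g_sigma_algebraType (pointed_zmod _) (val_open val)).
Notation borelV val d :=
  (@g_sigma_algebraType (pointed_zmod 'cV[_]_d) (@vec_open _ _ val d)).

Section Gaussian.
Context {R : realType} {K : fieldType} (val : K -> \bar R).

(* These two conditions determine the Haar measure on Borel sets: finiteness on
   compact sets and regularity follow from them for local fields. *)
Definition normalized_haar (mu : {measure set (borelK val) -> \bar R}) : Prop :=
  mu (valuation_ring val) = 1 /\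
  forall (a : K) (B : set (borelK val)), measurable B ->
    mu [set (a + x)%R | x in (B : set K)] = mu B.

(* nu is the product measure of d copies of mu (unique for sigma-finite mu). *)
Definition product_power (d : nat) (mu : {measure set (borelK val) -> \bar R})
    (nu : {measure set (borelV val d) -> \bar R}) : Prop :=
  forall B : 'I_d -> set (borelK val), (forall i, measurable (B i)) ->
    nu [set x : 'cV[K]_d | forall i, B i (x i ord0)] = \prod_(i < d) mu (B i).

Definition gaussian (d : nat) (nu : {measure set (borelV val d) -> \bar R})
    (L B : set 'cV[K]_d) : \bar R := nu (L `&` B) / nu L.

End Gaussian.

Definition logqe {R : realType} (q : nat) (x : \bar R) : \bar R :=
  lne x / (ln q%:R)%:E.

(* Real-valuedness is required so that the inequality is not trivialized by
   infinite values. *)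
Definition supermodular {R : realType} (d : nat) (h : {set 'I_d} -> \bar R) :
    Prop :=
  [/\ forall I, h I \is a fin_num,
      h finset.set0 = 0
    & forall I J, h I + h J <= h (I :&: J)%SET + h (I :|: J)%SET].

(* Main.v *)
Require Import Defs.
From HB Require Import structures.
From mathcomp Require Import all_boot all_order all_algebra.
From mathcomp Require Import fingroup perm.
From mathcomp Require Import all_classical all_reals all_analysis.
From mathcomp Require Import lra.

Set Implicit Arguments.
Unset Strict Implicit.
Unset Printing Implicit Defensive.

Import Order.TTheory GRing.Theory Num.Theory.

Local Open Scope classical_set_scope.
Local Open Scope ring_scope.
Local Open Scope ereal_scope.

(** Why the theorem holds.

    Call an entry of K integral when its valuation is nonnegative.  By
    multilinearity of the determinant in the columns ([det_mulmx_sum]) every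
    minor of M W is a combination of minors of M with the same rows, with
    coefficients that are products of entries of W.  If W is integral, a lower
    bound for the valuations of the minors of M on given rows is therefore a
    lower bound for those of M W.  Two representatives of a lattice differ by
    an integral matrix with integral inverse, so h_I depends only on the
    lattice ([entropy_mx_representative]).  All statements about h_I go through
    the pair [entropy_mx_le], [entropy_mx_attained], which replaces subsets of
    columns by arbitrary families of columns.

    Supermodularity.  For i outside I, let r_i be the i-th row of A.  Then
    h_{I+i} - h_I is the distance, in valuation, from r_i to the span of the
    rows of I: it is the largest value of min_j val((r_i - u)_j) for u in that
    span.  Subtracting u from r_i changes no minor, so Laplace expansion along
    the new row bounds the difference below ([entropy_mx_add_row_ge]); the u
    that cancels r_i on an optimal set of columns attains it
    ([entropy_mx_add_row_le]).  A supremum over a larger span is larger, so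
    h_{I+i} - h_I increases with I, which is supermodularity.

    Distribution of val(X).  Let D be the diagonal matrix of the pi^{v_i}.  The
    vectors with val(x_i) >= v_i form the lattice D O^d.  The Smith form over O
    of D^{-1} A, where L = A O^d, gives A = D U diag(t) W with U, W invertible
    over O ([smith_form]).  Hence, with F = D U and tau_i = val(t_i),
    L, D O^d and their intersection are the images under F of the boxes of
    vectors whose i-th entry has valuation at least tau_i, 0 and max(tau_i, 0)
    respectively.  The measure of F(box a) is q^{- sum_i (v_i + a_i)}
    ([haar_lattice_coset]), so the probability is q^e with
    e = sum_i min(0, tau_i).  On the other side,
    max_I (sum_{i in I} v_i - h_I(L)) is minus the smallest valuation of a minor
    of D^{-1} A; this number is unchanged by U and W and for diag(t) it is
    sum_i min(0, tau_i) = e ([tropical_entropy]).  Finally, an entry of X has an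
    integer valuation unless it is 0, and coordinate hyperplanes have measure 0
    ([haar_hyperplane]). *)

(** * Determinants and inverses *)

(** A weak Cauchy-Binet formula, over families of columns instead of subsets:
    the terms of non-injective families vanish, and those of a subset are not
    collected.  It suffices for estimates, and it avoids all signs. *)
Lemma det_mulmx_sum (K : comNzRingType) (k d : nat) (M : 'M[K]_(k, d))
    (N : 'M[K]_(d, k)) :
  \det (M *m N) =
  (\sum_(f : {ffun 'I_k -> 'I_d}) (\prod_i N (f i) i) * \det (colsub f M))%R.
Proof.
transitivity (\sum_(f : {ffun 'I_k -> 'I_d}) \sum_(s : 'S_k)
   (-1) ^+ s * \prod_i (M (s i) (f i) * N (f i) i))%R.
  rewrite exchange_big -det_tr; apply: eq_bigr => /= s _; rewrite -big_distrr /=.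
  congr (_ * _)%R; rewrite -(bigA_distr_bigA (fun i j => M (s i) j * N j i)%R) /=.
  by apply: eq_bigr => x _; rewrite !mxE.
apply: eq_bigr => f _; rewrite -det_tr big_distrr /=; apply: eq_bigr => s _.
rewrite big_split //= mulrA mulrC; congr (_ * (_ * _))%R.
by apply: eq_bigr => x _; rewrite !mxE.
Qed.

Lemma invmx_unique (K : comUnitRingType) n (A B : 'M[K]_n) :
  A *m B = 1%:M -> invmx A = B.
Proof.
by move=> AB; have [Au _] := mulmx1_unit AB; rewrite -[LHS]mulmx1 -AB mulKmx.
Qed.

(** * Valuations of sums and products *)

Section Valuation.
Context {R : realType} {K : fieldType} (val : K -> \bar R).
Context (vP : valuation val).

Let val_gtNy x : val x != -oo. Proof. by case: vP. Qed.
Let val0 : val 0%R = +oo. Proof. by case: vP => _ /(_ 0%R)[_ ->]. Qed.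
Let valM x y : val (x * y)%R = val x + val y. Proof. by case: vP. Qed.

Lemma val_fin_num x : x != 0%R -> val x \is a fin_num.
Proof.
move=> /eqP x0; rewrite fin_numE val_gtNy /=; apply/eqP => vx.
by case: vP => _ /(_ x)[/(_ vx)].
Qed.

Lemma val_one : val 1%R = 0.
Proof.
have := valM 1 1; rewrite mulr1.
case: (val 1%R) (val_fin_num (oner_neq0 K)) => // r _ /eqP.
by rewrite -EFinD eqe -subr_eq0 opprD addNKr oppr_eq0 => /eqP ->.
Qed.

Lemma valN x : val (- x)%R = val x.
Proof.
rewrite -mulN1r valM; suff -> : val (-1)%R = 0 by rewrite add0e.
have := valM (-1) (-1); rewrite mulrNN mulr1 val_one.
have N1 : (-1 : K)%R != 0%R by rewrite oppr_eq0 oner_neq0.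
case: (val (-1)%R) (val_fin_num N1) => // r _ /eqP.
by rewrite -EFinD eq_sym eqe -mulr2n mulrn_eq0 => /eqP ->.
Qed.

Lemma le_valD c x y : c <= val x -> c <= val y -> c <= val (x + y)%R.
Proof.
move=> cx cy; case: vP => _ _ _ /(_ x y); apply: le_trans.
by rewrite le_min cx cy.
Qed.

Lemma le_valB c x y : c <= val x -> c <= val y -> c <= val (x - y)%R.
Proof. by move=> cx cy; apply: le_valD; rewrite ?valN. Qed.

Lemma le_val_sum c (I : Type) (r : seq I) (P : pred I) (F : I -> K) :
  (forall i, P i -> c <= val (F i)) -> c <= val (\sum_(i <- r | P i) F i)%R.
Proof.
move=> cF; elim/big_ind: _ => //; first by rewrite val0 leey.
exact: le_valD.
Qed.

Lemma val_prod (I : Type) (r : seq I) (P : pred I) (F : I -> K) :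
  val (\prod_(i <- r | P i) F i)%R = \sum_(i <- r | P i) val (F i).
Proof. by rewrite (big_morph val valM val_one). Qed.

Lemma val_sign n x : val ((-1) ^+ n * x)%R = val x.
Proof. by rewrite -signr_odd; case: odd; rewrite ?mulN1r ?mul1r ?valN. Qed.

Lemma val_inv x : x != 0%R -> val x^-1%R = - val x.
Proof.
move=> x0; have := valM x^-1 x; rewrite mulVf // val_one.
have xV0 : x^-1%R != 0%R by rewrite invr_eq0.
case: (val x) (val_fin_num x0) => // r _.
case: (val _) (val_fin_num xV0) => // s _ /eqP.
by rewrite -EFinD eq_sym eqe addr_eq0 => /eqP ->.
Qed.

(** * Matrices with entries in the valuation ring *)

Definition integral_mx m n (U : 'M[K]_(m, n)) : Prop :=
  forall i j, 0 <= val (U i j).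

Lemma integral_mx1 n : integral_mx (1%:M : 'M[K]_n).
Proof.
by move=> i j; rewrite mxE mulrb; case: eqP; rewrite ?val_one ?val0 ?leey.
Qed.

Lemma integral_mulmx m n p (U : 'M[K]_(m, n)) (W : 'M[K]_(n, p)) :
  integral_mx U -> integral_mx W -> integral_mx (U *m W).
Proof.
move=> iU iW i j; rewrite mxE; apply: le_val_sum => l _.
by rewrite valM; apply: adde_ge0.
Qed.

Lemma entries_ge_mulmx c m n (U : 'M[K]_(m, n)) (w : 'cV[K]_n) :
  integral_mx U -> (forall i, c <= val (w i ord0)) ->
  forall i, c <= val ((U *m w) i ord0).
Proof.
move=> iU cw i; rewrite mxE; apply: le_val_sum => j _.
by rewrite valM -(add0e c) leeD.
Qed.

Lemma integral_det n (U : 'M[K]_n) : integral_mx U -> 0 <= val (\det U).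
Proof.
move=> iU; apply: le_val_sum => s _; rewrite val_sign val_prod.
exact: sume_ge0.
Qed.

(** * Minors and the entropy map *)

(** Each minor of M W is a combination of minors of M on the same rows, with
    coefficients that are products of entries of W. *)
Lemma minor_ge_mulr c k m d (M : 'M[K]_(m, d)) (W : 'M[K]_d)
    (g : 'I_k -> 'I_m) (f : 'I_k -> 'I_d) :
  integral_mx W -> (forall f', c <= val (\det (mxsub g f' M))) ->
  c <= val (\det (mxsub g f (M *m W))).
Proof.
move=> iW cM; rewrite mxsub_mul det_mulmx_sum; apply: le_val_sum => h _.
have -> : colsub h (rowsub g M) = mxsub g h M by apply/matrixP=> i j; rewrite !mxE.
rewrite valM -(add0e c) leeD // val_prod.
by rewrite sume_ge0 // => i _; rewrite !mxE.
Qed.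

Lemma minor_ge_mull c k m d (M : 'M[K]_(m, d)) (U : 'M[K]_m)
    (g : 'I_k -> 'I_m) (f : 'I_k -> 'I_d) :
  integral_mx U -> (forall g', c <= val (\det (mxsub g' f M))) ->
  c <= val (\det (mxsub g f (U *m M))).
Proof.
move=> iU cM; rewrite -det_tr trmx_mxsub trmx_mul; apply: minor_ge_mulr.
  by move=> i j; rewrite mxE.
by move=> g'; rewrite -trmx_mxsub det_tr.
Qed.

(** Families of columns with a repetition contribute valuation +oo, so they
    may be added to a minimum of minors at no cost. *)
Lemma minor_noninj k m d (M : 'M[K]_(m, d)) (g : 'I_k -> 'I_m)
    (f : 'I_k -> 'I_d) : ~ injective f -> \det (mxsub g f M) = 0%R.
Proof.
move=> /injectiveP/injectivePn[i [j ij fij]]; rewrite -det_tr.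
by apply: (determinant_alternate ij) => x; rewrite !mxE fij.
Qed.

Lemma enum_perm k (T : finType) (g h : 'I_k -> T) :
  injective g -> injective h -> (g @: 'I_k = h @: 'I_k)%SET ->
  exists s : 'S_k, forall i, g i = h (s i).
Proof.
move=> gI hI gh.
have ex i : {j | g i = h j}.
  apply: cid; have : g i \in (h @: 'I_k)%SET by rewrite -gh imset_f.
  by move=> /imsetP[j _ ->]; exists j.
have sI : injective (fun i => projT1 (ex i)).
  move=> i j /(congr1 h); case: (ex i) => /= a <-; case: (ex j) => /= b <-.
  exact: gI.
by exists (perm sI) => i; rewrite permE; case: (ex i).
Qed.

Lemma val_minor_perm k m d (M : 'M[K]_(m, d)) (g h : 'I_k -> 'I_m)
    (f e : 'I_k -> 'I_d) (s t : 'S_k) :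
  (forall i, g i = h (s i)) -> (forall i, f i = e (t i)) ->
  val (\det (mxsub g f M)) = val (\det (mxsub h e M)).
Proof.
move=> gh fe.
have -> : mxsub g f M = perm_mx s *m mxsub h e M *m (perm_mx t)^T.
  by apply/matrixP=> i j; rewrite tr_perm_mx -row_permE -col_permE !mxE gh fe.
by rewrite !det_mulmx det_tr !det_perm mulrC !val_sign.
Qed.

(** The valuation forgets signs, so a minor may be computed with any
    enumeration of its rows and columns. *)
Lemma val_minor_enum d (A : 'M[K]_d) k l (g f : 'I_k -> 'I_d)
    (h e : 'I_l -> 'I_d) :
  injective g -> injective f -> injective h -> injective e ->
  (g @: 'I_k = h @: 'I_l)%SET -> (f @: 'I_k = e @: 'I_l)%SET ->
  val (\det (mxsub g f A)) = val (\det (mxsub h e A)).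
Proof.
move=> gI fI hI eI gh fe.
have kl : k = l.
  by have := congr1 (fun X : {set _} => #|X|) gh; rewrite !card_imset // !card_ord.
subst l; have [s gs] := enum_perm gI hI gh; have [t ft] := enum_perm fI eI fe.
exact: val_minor_perm gs ft.
Qed.

Lemma imset_enum_val (T : finType) (I : {set T}) :
  ((fun i : 'I_#|I| => enum_val i) @: 'I_#|I|)%SET = I.
Proof.
apply/setP=> x; apply/imsetP/idP => [[i _ ->]|xI]; first exact: enum_valP.
by exists (enum_rank_in xI x); rewrite ?enum_rankK_in.
Qed.

(** Eliminates the cast hidden in [submx_IJ]. *)
Lemma submx_IJP d (A : 'M[K]_d) (I J : {set 'I_d}) : #|J| = #|I| ->
  exists e : 'I_#|I| -> 'I_d, [/\ injective e, (e @: 'I_#|I|)%SET = J &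
    submx_IJ A I J = mxsub (fun i => enum_val i) e A].
Proof.
move=> JI; rewrite /submx_IJ.
have : injective (fun j : 'I_#|J| => enum_val j) by exact: enum_val_inj.
have := imset_enum_val J.
move: (fun j : 'I_#|J| => enum_val j); rewrite JI => h hJ h_inj.
by exists h; rewrite conform_mx_id.
Qed.

(** Together with [entropy_mx_attained], this describes the entropy as a
    minimum over all families of columns, for any enumeration g of the rows. *)
Lemma entropy_mx_le d (A : 'M[K]_d) k (g f : 'I_k -> 'I_d) :
  injective g -> entropy_mx val A (g @: 'I_k)%SET <= val (\det (mxsub g f A)).
Proof.
move=> gI; have [fI|/minor_noninj ->] := pselect (injective f); last first.
  by rewrite val0 leey.
have JI : #|(f @: 'I_k)%SET| = #|(g @: 'I_k)%SET| by rewrite !card_imset.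
have [e [eI eJ subE]] := submx_IJP A JI.
rewrite (val_minor_enum A gI fI enum_val_inj eI (esym (imset_enum_val _)) (esym eJ)).
by rewrite -subE; apply: bigmin_le_cond; rewrite JI.
Qed.

Lemma entropy_mx_attained d (A : 'M[K]_d) k (g : 'I_k -> 'I_d) :
  injective g ->
  exists f, entropy_mx val A (g @: 'I_k)%SET = val (\det (mxsub g f A)).
Proof.
move=> gI; set I := (g @: 'I_k)%SET.
have leF (J : {set 'I_d}) : #|J| == #|I| -> val (\det (submx_IJ A I J)) <= +oo.
  by rewrite leey.
have [J /eqP JI] := @eq_bigmin _ _ _ +oo I (fun J : {set 'I_d} => #|J| == #|I|)
  _ (eqxx _) leF.
rewrite -/(entropy_mx val A I) => ->.
have kI : k = #|I| by rewrite card_imset // card_ord.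
have [e [eI eJ ->]] := submx_IJP A JI.
pose f i := e (cast_ord kI i).
have fI : injective f by move=> i j /eI /cast_ord_inj.
exists f; apply: val_minor_enum => //; first exact: enum_val_inj.
  exact: imset_enum_val.
apply/setP=> x; apply/imsetP/imsetP => -[i _ ->]; last by exists (cast_ord kI i).
by exists (cast_ord (esym kI) i); rewrite // /f cast_ordKV.
Qed.

Lemma entropy_mx_ge c d (A : 'M[K]_d) k (g : 'I_k -> 'I_d) :
  injective g -> (forall f, c <= val (\det (mxsub g f A))) ->
  c <= entropy_mx val A (g @: 'I_k)%SET.
Proof. by move=> gI cA; have [f ->] := entropy_mx_attained A gI. Qed.

Lemma entropy_mx_le_mulr d (A U : 'M[K]_d) I :
  integral_mx U -> entropy_mx val A I <= entropy_mx val (A *m U) I.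
Proof.
move=> iU; have gI := @enum_val_inj _ (mem I); rewrite -(imset_enum_val I).
apply: entropy_mx_ge => // f; apply: minor_ge_mulr => // f'.
exact: entropy_mx_le.
Qed.

Lemma entropy_mx_set0 d (A : 'M[K]_d) : entropy_mx val A finset.set0 = 0.
Proof.
have gI : injective (fun i : 'I_0 => match i return 'I_d with Ordinal _ h => False_rect _ (notF h) end).
  by case.
have [f] := entropy_mx_attained A gI.
rewrite det_mx00 val_one => <-; congr entropy_mx.
by apply/setP=> x; rewrite inE; apply/esym/imsetP => -[[]].
Qed.

(** The rows g of A times the columns g of its inverse give the identity, whose
    determinant would be 0 by [det_mulmx_sum] if all these minors vanished. *)
Lemma unitmx_minor_neq0 d (A : 'M[K]_d) k (g : 'I_k -> 'I_d) :
  injective g -> A \in unitmx -> exists f, \det (mxsub g f A) != 0%R.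
Proof.
move=> gI Au; apply/not_existsP => A0.
have : \det (rowsub g A *m colsub g (invmx A)) = 1%R.
  rewrite -mxsub_mul mulmxV // -[RHS](det1 K k); congr (\det _).
  by apply/matrixP=> i j; rewrite !mxE (inj_eq gI).
rewrite det_mulmx_sum big1 => [/eqP|f _]; first by rewrite eq_sym oner_eq0.
have -> : colsub f (rowsub g A) = mxsub g f A by apply/matrixP=> i j; rewrite !mxE.
by have /negP := A0 f; rewrite negbK => /eqP ->; rewrite mulr0.
Qed.

Lemma entropy_mx_fin_num d (A : 'M[K]_d) I :
  A \in unitmx -> entropy_mx val A I \is a fin_num.
Proof.
move=> Au; rewrite -(imset_enum_val I).
have gI := @enum_val_inj _ (mem I).
have [f f0] := unitmx_minor_neq0 gI Au; have [f' E] := entropy_mx_attained A gI.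
rewrite E fin_numE val_gtNy -E; apply/negP => /eqP E'.
have := entropy_mx_le A f gI; rewrite E' leye_eq.
by have := val_fin_num f0; rewrite fin_numE => /andP[_ /negPf->].
Qed.

(** * Adding one row: supermodularity *)

Section AddRow.
Context (d k : nat) (A : 'M[K]_d) (g : 'I_k -> 'I_d) (i0 : 'I_d).
Context (g_inj : injective g) (gi0 : i0 \notin (g @: 'I_k)%SET).

Definition cons_ord (x : 'I_d) (h : 'I_k -> 'I_d) (i : 'I_(1 + k)) : 'I_d :=
  match fintype.split i with inl _ => x | inr j => h j end.

Lemma cons_ord_inj : injective (cons_ord i0 g).
Proof.
move=> i j; rewrite /cons_ord.
case: (splitP i) => i' ei; case: (splitP j) => j' ej E; apply: val_inj => /=.
- by rewrite ei ej !ord1.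
- by case/negP: gi0; apply/imsetP; exists j'.
- by case/negP: gi0; apply/imsetP; exists i'.
- by rewrite ei ej (g_inj E).
Qed.

Lemma imset_cons_ord : (cons_ord i0 g @: 'I_(1 + k) = i0 |: g @: 'I_k)%SET.
Proof.
apply/setP=> x; rewrite !inE; apply/imsetP/orP => [[j _ ->]|].
  rewrite /cons_ord; case: (fintype.split j) => j'; first by left.
  by right; rewrite imset_f.
case=> [/eqP ->|/imsetP[j _ ->]].
  by exists (lshift k ord0); rewrite // /cons_ord (unsplitK (inl _)).
by exists (rshift 1 j); rewrite // /cons_ord (unsplitK (inr _)).
Qed.

(** Row reduction: the row i0 may be replaced by its difference with any
    combination of the rows g. *)
Lemma det_row_reduce (u : 'rV[K]_k) (f : 'I_(1 + k) -> 'I_d) :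
  \det (mxsub (cons_ord i0 g) f A) =
  \det (colsub f (col_mx (row i0 A - u *m rowsub g A)%R (rowsub g A))).
Proof.
have -> : mxsub (cons_ord i0 g) f A =
    block_mx 1%:M u 0%R 1%:M *m
    colsub f (col_mx (row i0 A - u *m rowsub g A)%R (rowsub g A)).
  rewrite mulmx_colsub mul_block_col !mul1mx mul0mx add0r subrK.
  apply/matrixP=> i j; rewrite !mxE /cons_ord.
  by case: (splitP i) => i' _; rewrite !mxE.
by rewrite det_mulmx det_ublock !det1 !mul1r.
Qed.

(** Laplace expansion along the reduced row: each cofactor is a minor on the
    rows g, hence has valuation at least their entropy. *)
Lemma entropy_mx_add_row_ge c (u : 'rV[K]_k) :
  (forall j, c <= val ((row i0 A - u *m rowsub g A)%R ord0 j)) ->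
  c + entropy_mx val A (g @: 'I_k)%SET <= entropy_mx val A (i0 |: g @: 'I_k)%SET.
Proof.
move=> cu; rewrite -imset_cons_ord; apply: entropy_mx_ge; first exact: cons_ord_inj.
move=> f; rewrite (det_row_reduce u) (expand_det_row _ ord0).
apply: le_val_sum => j _; rewrite valM leeD //.
  have -> : ord0 = lshift k (ord0 : 'I_1) by apply: val_inj.
  by rewrite mxE col_mxEu.
rewrite /cofactor val_sign.
have -> : row' (ord0 : 'I_k.+1) (col' j (colsub f
    (col_mx (row i0 A - u *m rowsub g A)%R (rowsub g A)))) =
    mxsub g (fun l : 'I_k => f (lift j l)) A; last exact: entropy_mx_le.
apply/matrixP=> a b; rewrite !mxE.
have -> : lift ord0 a = rshift 1 a by apply: val_inj.
by rewrite (unsplitK (inr _)) mxE.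
Qed.

(** The bound of [entropy_mx_add_row_ge] is attained.  Choose columns f on which
    the rows g have a minor of least valuation, and let u be the combination
    that agrees with row i0 on these columns.  Adding any column j to f gives a
    block triangular minor, the product of the reduced entry j and of that
    minor. *)
Lemma entropy_mx_add_row_le : A \in unitmx -> exists u : 'rV[K]_k,
  forall j, entropy_mx val A (i0 |: g @: 'I_k)%SET <=
    val ((row i0 A - u *m rowsub g A)%R ord0 j) + entropy_mx val A (g @: 'I_k)%SET.
Proof.
move=> Au; have [f E] := entropy_mx_attained A g_inj.
have Mu : mxsub g f A \in unitmx.
  rewrite unitmxE unitfE; apply/eqP => M0; have := entropy_mx_fin_num (g @: 'I_k)%SET Au.
  by rewrite E M0 val0.
(* u solves u *m (rows g, columns f of A) = row i0 on the columns f *)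
exists (colsub f (row i0 A) *m invmx (mxsub g f A)) => j.
set u := (X in (X *m _)%R).
rewrite E -imset_cons_ord -valM; apply: le_trans (entropy_mx_le _ (cons_ord j f) cons_ord_inj) _.
rewrite (det_row_reduce u).
rewrite (_ : colsub _ _ = block_mx ((row i0 A - u *m rowsub g A)%R ord0 j)%:M 0%R
   (colsub (fun=> j) (rowsub g A)) (mxsub g f A)).
  by rewrite det_lblock det_scalar1.
have uf0 l : ((row i0 A - u *m rowsub g A) ord0 (f l) = 0)%R.
  have := mulmxKV Mu (colsub f (row i0 A)); rewrite -/u => /matrixP/(_ ord0 l).
  rewrite !mxE => <-; apply/eqP; rewrite subr_eq0; apply/eqP.
  by apply: eq_bigr => x _; rewrite !mxE.
apply/matrixP=> a b; rewrite mxE /cons_ord [LHS]mxE [RHS]mxE.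
case: (splitP a) => a' _; rewrite [RHS]mxE; case: (splitP b) => b' _.
- by rewrite !ord1 [RHS]mxE eqxx mulr1n.
- by rewrite ord1 uf0 mxE.
- by rewrite !mxE.
- by rewrite !mxE.
Qed.
End AddRow.

(** The increment of the entropy when a row i is added to S is attained by some
    combination u of the rows of S; for T containing S, the same u is an
    admissible combination of the rows of T, so the increment over T is at least
    as large.  Adding the elements of I outside J one at a time, to the
    intersection and to J in parallel, gives the general inequality. *)
Lemma entropy_mx_supermodular d (A : 'M[K]_d) :
  A \in unitmx -> supermodular (entropy_mx val A).
Proof.
move=> Au; have hfin I := entropy_mx_fin_num I Au.
split=> //; first exact: entropy_mx_set0.
set h := entropy_mx val A.
pose r I := fine (h I); have hE I : h I = (r I)%:E by rewrite fineK.
have local (S T : {set 'I_d}) i : S \subset T -> i \notin T ->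
    (r (i |: S)%SET + r T <= r S + r (i |: T)%SET)%R.
  move=> ST iT; have iS : i \notin S by apply: contra iT; apply: (fintype.subsetP ST).
  have gS := @enum_val_inj _ (mem S); have gT := @enum_val_inj _ (mem T).
  have := @entropy_mx_add_row_le _ _ A _ i gS; rewrite imset_enum_val.
  move=> /(_ iS Au) [u]; rewrite -!/(h _) => hu.
  (* the same combination of rows of S, seen among the rows of T *)
  pose w : 'rV[K]_#|T| := \row_l (\sum_(j : 'I_#|S| | enum_val j == enum_val l :> 'I_d) u ord0 j)%R.
  have uw : u *m rowsub enum_val A = w *m rowsub enum_val A.
    apply/rowP=> c; rewrite !mxE.
    under [RHS]eq_bigr do rewrite mxE big_distrl /=.
    rewrite (exchange_big_dep predT) //=; apply: eq_bigr => j _.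
    have jT : enum_val j \in T by apply: (fintype.subsetP ST); exact: enum_valP.
    rewrite (big_pred1 (enum_rank_in jT (enum_val j))); last first.
      move=> l; apply/eqP/eqP => [jl|->]; last by rewrite enum_rankK_in.
      by apply: enum_val_inj; rewrite enum_rankK_in.
    by rewrite !mxE enum_rankK_in.
  have := @entropy_mx_add_row_ge _ _ A _ i gT; rewrite imset_enum_val.
  move=> /(_ iT (r (i |: S)%SET - r S)%:E w).
  rewrite -uw -!/(h _) !hE -EFinD lee_fin => H.
  suff : (r (i |: S)%SET - r S + r T <= r (i |: T)%SET)%R by lra.
  apply: H => c; move: (hu c); rewrite !hE.
  have := val_gtNy ((row i A - u *m rowsub enum_val A)%R ord0 c).
  case: (val _) => [x _|_ _|//]; last by rewrite leey.
  by rewrite -EFinD !lee_fin; lra.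
(* sums the local inequalities along an enumeration xs of the added rows *)
have chain (xs : seq 'I_d) : forall S T : {set 'I_d}, S \subset T ->
    uniq xs -> {in xs, forall x, x \notin T} ->
    (r (S :|: [set x in xs])%SET + r T <= r S + r (T :|: [set x in xs])%SET)%R.
  elim: xs => [|x xs IH] S T ST /=.
    have -> : [set x in [::]]%SET = finset.set0 :> {set 'I_d}.
      by apply/setP=> y; rewrite !inE.
    by rewrite !finset.setU0.
  move=> /andP[xxs uxs] xT.
  have E (Z : {set 'I_d}) : (Z :|: [set y in x :: xs] = (x |: Z) :|: [set y in xs])%SET.
    by apply/setP=> y; rewrite !inE orbCA orbA.
  rewrite !E.
  have := local S T x ST (xT x (mem_head _ _)).
  have := IH (x |: S)%SET (x |: T)%SET (finset.setUS _ ST) uxs.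
  set H := (X in (X -> _) -> _).
  suff h0 : H by move=> /(_ h0); lra.
  move=> y yxs; rewrite !inE negb_or xT ?inE ?yxs ?orbT // andbT.
  by apply: contraNneq xxs => <-.
move=> I J; rewrite -!/(h _) !hE -!EFinD lee_fin.
have := chain (enum (I :\: J)%SET) (I :&: J)%SET J (finset.subsetIr _ _) (enum_uniq _).
set H := (X in (X -> _) -> _).
have h0 : H by move=> x; rewrite mem_enum !inE => /andP[].
move=> /(_ h0).
have -> : (I :&: J :|: [set x in enum (I :\: J)] = I)%SET.
  by apply/setP=> x; rewrite !inE mem_enum !inE; case: (x \in I); case: (x \in J).
suff -> : (J :|: [set x in enum (I :\: J)] = I :|: J)%SET by lra.
by apply/setP=> x; rewrite !inE mem_enum !inE; case: (x \in I); case: (x \in J).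
Qed.

(** * Independence of the representative *)

Lemma representativeP d (A : 'M[K]_d) L (x : 'cV[K]_d) :
  representative val A L -> (L x <-> integral_mx (invmx A *m x)).
Proof.
move=> [Au ->]; split=> [[y yO <-]|xO].
  rewrite mulKmx // => i j; rewrite ord1; exact: yO.
by exists (invmx A *m x); [move=> i; exact: xO|rewrite mulKVmx].
Qed.

Lemma representative_transition d (A B : 'M[K]_d) L :
  representative val A L -> representative val B L ->
  integral_mx (invmx B *m A).
Proof.
move=> rA rB i j.
have : L (col j A).
  apply/(representativeP _ rA); rewrite colE mulmxA mulVmx ?(proj1 rA) // mul1mx.
  by move=> a b; rewrite mxE mulrb; case: ifP; rewrite ?val_one ?val0 ?leey.
move/(representativeP _ rB)/(_ i ord0).
by rewrite colE mulmxA -colE mxE.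
Qed.

Lemma entropy_mx_representative d (A B : 'M[K]_d) L I :
  representative val A L -> representative val B L ->
  entropy_mx val A I = entropy_mx val B I.
Proof.
have le (C D : 'M[K]_d) : representative val C L -> representative val D L ->
    entropy_mx val D I <= entropy_mx val C I.
  move=> rC rD; rewrite -[X in _ <= entropy_mx val X _](mulKVmx (proj1 rD)).
  by apply/entropy_mx_le_mulr/representative_transition; first exact: rC.
by move=> rA rB; apply/le_anti; rewrite !le.
Qed.

Lemma entropyE d (A : 'M[K]_d) L : representative val A L ->
  entropy val L = entropy_mx val A.
Proof.
move=> rA; apply/funext => I; apply: (entropy_mx_representative I _ rA).
have : exists B : 'M[K]_d, [set B | representative val B L] B by exists A.
by move=> /(xgetPex 1%:M%R).
Qed.

(** * Smith normal form over the valuation ring *)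

Definition integral_unitmx n (U : 'M[K]_n) :=
  [/\ U \in unitmx, integral_mx U & integral_mx (invmx U)].

Lemma integral_unitmxM n (U W : 'M[K]_n) :
  integral_unitmx U -> integral_unitmx W -> integral_unitmx (U *m W).
Proof.
move=> [Uu iU iU'] [Wu iW iW']; split; first by rewrite unitmx_mul Uu.
  exact: integral_mulmx.
have -> : invmx (U *m W) = invmx W *m invmx U.
  by apply: invmx_unique; rewrite mulmxA mulmxK // mulmxV.
exact: integral_mulmx.
Qed.

(** The inverse is then the adjugate, whose entries are minors. *)
Lemma integral_unitmx_det n (U : 'M[K]_n) :
  integral_mx U -> \det U = 1%R -> integral_unitmx U.
Proof.
move=> iU dU; split=> //; first by rewrite unitmxE dU unitr1.
move=> i j; rewrite /invmx unitmxE dU unitr1 mxE invr1 mul1r mxE val_sign.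
by apply: integral_det => a b; rewrite !mxE.
Qed.

Lemma integral_unitmx_perm n (s : 'S_n) : integral_unitmx (perm_mx s).
Proof.
have iP (t : 'S_n) : integral_mx (perm_mx t).
  by move=> i j; rewrite !mxE mulrb; case: ifP; rewrite ?val_one ?val0 ?leey.
split=> //; first exact: unitmx_perm.
rewrite (_ : invmx _ = perm_mx (s^-1)%g) //.
by apply: invmx_unique; rewrite -perm_mxM mulgV perm_mx1.
Qed.

Lemma integral_block_mx m1 m2 n1 n2 (Aul : 'M[K]_(m1, n1)) (Aur : 'M[K]_(m1, n2))
    (Adl : 'M[K]_(m2, n1)) (Adr : 'M[K]_(m2, n2)) :
  integral_mx Aul -> integral_mx Aur -> integral_mx Adl -> integral_mx Adr ->
  integral_mx (block_mx Aul Aur Adl Adr).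
Proof.
move=> ul ur dl dr i j; rewrite mxE.
by case: (splitP i) => i' _; rewrite mxE; case: (splitP j) => j' _.
Qed.

Lemma integral_mx0 m n : integral_mx (0 : 'M[K]_(m, n))%R.
Proof. by move=> i j; rewrite mxE val0 leey. Qed.

Lemma integral_unitmx_block n (U : 'M[K]_n) : integral_unitmx U ->
  integral_unitmx (block_mx (1%:M : 'M[K]_1) 0%R 0%R U).
Proof.
move=> [Uu iU iU']; have i1 := @integral_mx1 1; have i0 := @integral_mx0.
rewrite /integral_unitmx.
have -> : invmx (block_mx (1%:M : 'M[K]_1) 0%R 0%R U) =
    block_mx (1%:M : 'M[K]_1) 0%R 0%R (invmx U).
  apply: invmx_unique; rewrite mulmx_block !mul1mx !mul0mx !mulmx0 mulmxV //.
  by rewrite !addr0 add0r -scalar_mx_block.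
split; [|exact: integral_block_mx|exact: integral_block_mx].
by rewrite unitmxE det_ublock det1 mul1r -unitmxE.
Qed.

(** Gaussian elimination with an entry of least valuation as pivot: this choice
    makes all the multipliers of the elimination integral. *)
Lemma smith_form n (M : 'M[K]_n) : exists (U W : 'M[K]_n) (t : 'rV[K]_n),
  [/\ integral_unitmx U, integral_unitmx W & M = U *m diag_mx t *m W].
Proof.
elim: n M => [|n IH] M.
  exists 1%:M, 1%:M, 0%R.
  split; last by apply/matrixP => -[].
  by split; [rewrite unitmx1|case|case].
  by split; [rewrite unitmx1|case|case].
pose ij := [arg min_(p < (ord0, ord0) : 'I_n.+1 * 'I_n.+1) val (M p.1 p.2)]%O.
have ij_min i j : val (M ij.1 ij.2) <= val (M i j).
  rewrite /ij; case: Order.TotalTheory.arg_minP => //= p _ pmin; exact: (pmin (i, j)).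
pose s := tperm ord0 ij.1; pose t := tperm ord0 ij.2.
(* N has the pivot in its corner *)
pose N : 'M[K]_(1 + n) := perm_mx s *m M *m perm_mx t.
have NE i j : N i j = M (s i) (t j).
  by rewrite /N -row_permE -[t]invgK -col_permE !mxE invgK /t tpermV.
have ME : M = perm_mx s *m N *m perm_mx t.
  apply/matrixP=> i j; rewrite -row_permE -[t]invgK -col_permE 2!mxE.
  by rewrite NE /s /t tpermV !tpermK.
have Nmin i j : val (N ord0 ord0) <= val (N i j) by rewrite !NE !tpermL.
pose a := N ord0 ord0; have [a0|a_neq0] := eqVneq a 0%R.
  have N0 : N = 0%R.
    apply/matrixP=> i j; rewrite [RHS]mxE.
    have := Nmin i j; rewrite -/a a0 val0 leye_eq => /eqP.
    by case: vP => _ + _ _ => /(_ (N i j))[+ _] => /[apply].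
  have iu1 : integral_unitmx (1%:M : 'M[K]_n.+1).
    by apply: integral_unitmx_det; [exact: integral_mx1|exact: det1].
  exists 1%:M, 1%:M, 0%R; split=> //.
  by rewrite ME N0 mulmx0 mul0mx raddf0 mulmx0 mul0mx.
pose c := dlsubmx N; pose r := ursubmx N.
(* the Schur complement of the pivot *)
pose D := (drsubmx N - a^-1 *: (c *m r))%R.
have [U [W [d [iuU iuW DE]]]] := IH D.
pose L1 := block_mx (1%:M : 'M[K]_1) 0%R (a^-1 *: c)%R (1%:M : 'M[K]_n).
pose R1 := block_mx (1%:M : 'M[K]_1) (a^-1 *: r)%R 0%R (1%:M : 'M[K]_n).
have va (x : K) : val a <= val x -> 0 <= val (a^-1 * x)%R.
  by move=> ax; rewrite valM val_inv // addeC sube_ge0 // val_fin_num ?orbT.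
have cE i j : c i j = N (rshift 1 i) (lshift n j) by rewrite /c !mxE.
have rE i j : r i j = N (lshift n i) (rshift 1 j) by rewrite /r !mxE.
have iL : integral_unitmx L1.
  apply: integral_unitmx_det; last by rewrite det_lblock !det1 mulr1.
  apply: integral_block_mx; [exact: integral_mx1|exact: integral_mx0| |exact: integral_mx1].
  by move=> i j; rewrite mxE cE; apply: va.
have iR : integral_unitmx R1.
  apply: integral_unitmx_det; last by rewrite det_ublock !det1 mulr1.
  apply: integral_block_mx; [exact: integral_mx1| |exact: integral_mx0|exact: integral_mx1].
  by move=> i j; rewrite mxE rE; apply: va.
have NLR : N = L1 *m block_mx a%:M 0%R 0%R D *m R1.
  rewrite !mulmx_block !mul1mx !mul0mx !mulmx0 !mulmx1 !addr0 !add0r.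
  rewrite mul_scalar_mx mul_mx_scalar !scalerA mulfV // !scale1r.
  rewrite -scalemxAr addrC subrK -[LHS]submxK; congr block_mx.
  by apply/matrixP=> i j; rewrite !ord1 [RHS]mxE eqxx mulr1n 2!mxE; congr (N _ _); apply: val_inj.
have mid : block_mx a%:M 0%R 0%R D = block_mx (1%:M : 'M[K]_1) 0%R 0%R U *m
    diag_mx (row_mx (a%:M : 'M[K]_1) d) *m block_mx (1%:M : 'M[K]_1) 0%R 0%R W.
  rewrite diag_mx_row !mulmx_block !mul1mx !mul0mx !mulmx0 !mulmx1 !addr0 !add0r DE.
  congr block_mx; last by rewrite mul0mx.
  by apply/matrixP=> i j; rewrite !ord1 !mxE !eqxx !mulr1n.
exists (perm_mx s *m (L1 *m block_mx (1%:M : 'M[K]_1) 0%R 0%R U)).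
exists (block_mx (1%:M : 'M[K]_1) 0%R 0%R W *m R1 *m perm_mx t).
exists (row_mx (a%:M : 'M[K]_1) d : 'rV_(1 + n)); split.
- apply: integral_unitmxM; first exact: integral_unitmx_perm.
  by apply: integral_unitmxM => //; exact: integral_unitmx_block.
- apply: integral_unitmxM; last exact: integral_unitmx_perm.
  by apply: integral_unitmxM => //; exact: integral_unitmx_block.
by rewrite ME NLR mid !mulmxA.
Qed.

(** * The tropical polynomial in terms of the Smith form *)

(** A lower bound for all minors at once: it compares least valuations of minors
    without introducing a minimum over all sizes. *)
Definition minors_ge c d (M : 'M[K]_d) : Prop :=
  forall k (g f : 'I_k -> 'I_d), c <= val (\det (mxsub g f M)).

(** Minors with a repeated row vanish. *)
Lemma minors_ge_inj c d (M : 'M[K]_d) :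
  (forall k (g f : 'I_k -> 'I_d), injective g -> c <= val (\det (mxsub g f M))) ->
  minors_ge c M.
Proof.
move=> cM k g f; have [gI|gI] := pselect (injective g); first exact: cM.
by rewrite -det_tr trmx_mxsub minor_noninj // val0 leey.
Qed.

Lemma minors_ge_mulmx c d (U M W : 'M[K]_d) :
  integral_mx U -> integral_mx W -> minors_ge c M -> minors_ge c (U *m M *m W).
Proof.
by move=> iU iW cM k g f; apply: minor_ge_mulr => // f'; apply: minor_ge_mull.
Qed.

(** The least valuation of a minor of a diagonal matrix is that of the principal
    minor on the entries of negative valuation. *)
Lemma minors_ge_diag c d (t : 'rV[K]_d) (tau : 'I_d -> R) :
  (forall i, val (t ord0 i) = (tau i)%:E) ->
  minors_ge c%:E (diag_mx t) <-> (c <= \sum_i Num.min 0 (tau i))%R.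
Proof.
move=> tE; split=> [|c_le].
  (* the principal minor that attains the bound *)
  set I := [set i | (tau i < 0)%R]%SET.
  move=> /(_ _ (fun i : 'I_#|I| => enum_val i) (fun i : 'I_#|I| => enum_val i)).
  rewrite (_ : mxsub _ _ _ = diag_mx (\row_i t ord0 (enum_val i))); last first.
    by apply/matrixP=> i j; rewrite !mxE (inj_eq enum_val_inj).
  rewrite det_diag val_prod.
  under eq_bigr do rewrite mxE tE.
  rewrite sumEFin -(big_enum_val tau) lee_fin.
  move=> /le_trans; apply; rewrite big_mkcond; apply: ler_sum => i _.
  by rewrite inE; case: ltP; rewrite ?minrElt.
apply: minors_ge_inj => k g f gI; apply: le_val_sum => s _; rewrite val_sign val_prod.
apply: (@le_trans _ _ (\sum_(i < k) (Num.min 0 (tau (g i)))%:E)).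
  rewrite sumEFin lee_fin (le_trans c_le) //.
  rewrite -(big_imset (fun i => Num.min 0 (tau i))%R (in2W gI)) /=.
  rewrite [leRHS]big_mkcond; apply: ler_sum => i _; case: ifP => // _.
  by rewrite ge_min lexx.
apply: lee_sum => i _; rewrite !mxE mulrb; case: ifP => _; last by rewrite val0 leey.
by rewrite tE lee_fin ge_min lexx orbT.
Qed.

(** Multiplying A by the inverse of diag(p) on the left subtracts the sum of v
    over I from the valuation of the minors with rows I.  So a real c bounds the
    left hand side above exactly when -c bounds below the valuations of all
    minors of U diag(t) W, or equivalently those of diag(t). *)
Lemma tropical_entropy d (p t : 'rV[K]_d) (U W A : 'M[K]_d) (v tau : 'I_d -> R) :
  (forall i, val (p ord0 i) = (v i)%:E) -> (forall i, val (t ord0 i) = (tau i)%:E) ->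
  integral_unitmx U -> integral_unitmx W -> A \in unitmx ->
  A = diag_mx p *m (U *m diag_mx t *m W) ->
  \big[maxe/-oo]_(I : {set 'I_d}) ((\sum_(i in I) v i)%R%:E - entropy_mx val A I)
  = (- \sum_i Num.min 0 (tau i))%R%:E.
Proof.
move=> pE tE [Uu iU iU'] [Wu iW iW'] Au AE.
set M := U *m diag_mx t *m W.
have minorA k (g f : 'I_k -> 'I_d) : injective g ->
    val (\det (mxsub g f A)) =
    (\sum_(i in (g @: 'I_k)%SET) v i)%R%:E + val (\det (mxsub g f M)).
  move=> gI; rewrite AE -/M.
  have -> : mxsub g f (diag_mx p *m M) =
      diag_mx (\row_i p ord0 (g i)) *m mxsub g f M.
    by apply/matrixP=> i j; rewrite mul_diag_mx mxE mul_diag_mx !mxE.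
  rewrite det_mulmx valM det_diag val_prod; congr (_ + _).
  rewrite (big_imset v (in2W gI)) /= -sumEFin.
  by apply: eq_bigr => i _; rewrite mxE pE.
have bound c : minors_ge (- c)%R%:E M <->
    forall I : {set 'I_d}, (\sum_(i in I) v i)%R%:E - entropy_mx val A I <= c%:E.
  split=> [cM I|cA].
    have [f] := entropy_mx_attained A (@enum_val_inj _ (mem I)).
    rewrite minorA ?imset_enum_val; last exact: enum_val_inj.
    move=> ->; move: (cM _ (fun i : 'I_#|I| => enum_val i) f).
    case: (val _) (val_gtNy (\det (mxsub (fun i : 'I_#|I| => enum_val i) f M))) => [x _|_ _|//]; last by rewrite leNye.
    by rewrite -!EFinD !lee_fin; lra.
  apply: minors_ge_inj => k g f gI.
  have := entropy_mx_le A f gI; rewrite minorA //.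
  have := cA (g @: 'I_k)%SET.
  have := entropy_mx_fin_num (g @: 'I_k)%SET Au.
  case: (entropy_mx _ _ _) => // h _; rewrite -EFinB lee_fin => hc.
  case: (val _) (val_gtNy (\det (mxsub g f M))) => [x _|_ _|//]; last by rewrite leey.
  by rewrite -EFinD !lee_fin; lra.
have boundt c : minors_ge (- c)%R%:E M <-> (- c <= \sum_i Num.min 0 (tau i))%R.
  rewrite -(minors_ge_diag _ tE); split; last exact: minors_ge_mulmx.
  move=> /(minors_ge_mulmx iU' iW').
  by rewrite /M -!mulmxA mulKmx // mulmxA mulmxK.
apply/le_anti/andP; split.
  apply/bigmax_leP; split; first by rewrite leNye.
  by move=> I _; apply: (bound _).1; rewrite boundt opprK.
set c := \big[maxe/-oo]_I _.
have cI (I : {set 'I_d}) : (\sum_(i in I) v i)%R%:E - entropy_mx val A I <= c.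
  exact: le_bigmax.
have : 0 <= c by have := cI finset.set0; rewrite big_set0 entropy_mx_set0 sube0.
case: c cI => [c cI _|_ _|//]; last by rewrite leey.
by rewrite lee_fin; have := (boundt c).1 ((bound c).2 cI); lra.
Qed.

End Valuation.

(** * Local fields: valuations, digits *)

Section LocalField.
Context {R : realType} {K : fieldType} (val : K -> \bar R) (q : nat).
Context (lfP : local_field val q).

Let vP : valuation val. Proof. by case: lfP. Qed.
Let val0 : val 0%R = +oo. Proof. by case: vP => _ /(_ 0%R)[_ ->]. Qed.
Let valM x y : val (x * y)%R = val x + val y. Proof. by case: vP. Qed.

Lemma val_int x : x != 0%R -> exists m : int, val x = (m%:~R)%:E.
Proof.
move=> x0; case: lfP => _ vZ _ _.
have : [set val x | x in [set x | x != 0%R]] (val x) by exists x.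
by rewrite vZ => -[m _ <-]; exists m.
Qed.

Lemma uniformizer_exists : exists2 p : K, p != 0%R & val p = 1.
Proof.
case: lfP => _ vZ _ _.
have : [set ((m%:~R : R)%:E) | m in [set: int]] 1 by exists 1%R.
by rewrite -vZ => -[p p0 vp]; exists p.
Qed.

Lemma val_gt_int (m : int) x : (m%:~R)%:E < val x -> ((m + 1)%:~R)%:E <= val x.
Proof.
have [->|/val_int[n ->]] := eqVneq x 0%R; first by rewrite val0 leey.
by rewrite lte_fin lee_fin ltr_int ler_int lezD1.
Qed.

Lemma val_exprz (p : K) (m : int) : p != 0%R -> val p = 1 -> val (p ^ m)%R = (m%:~R)%:E.
Proof.
move=> p0 vp.
have vX n : val (p ^+ n)%R = (n%:R)%:E.
  elim: n => [|n IH]; first by rewrite expr0 (val_one vP).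
  by rewrite exprS valM IH vp -EFinD -natr1 addrC.
case: m => n; first exact: vX.
by rewrite NegzE -[(p ^ _)%R]/((p ^+ n.+1)^-1)%R (val_inv vP) ?expf_neq0 // vX mulrNz EFinN.
Qed.

Lemma val_ge1 x : 0 < val x -> 1 <= val x.
Proof. exact: (@val_gt_int 0). Qed.

Lemma le_val_exprzM (p x : K) (m n : int) : p != 0%R -> val p = 1 ->
  (((m + n)%:~R)%:E <= val (p ^ m * x)%R) = ((n%:~R)%:E <= val x).
Proof. by move=> p0 vp; rewrite valM val_exprz // intrD EFinD leeD2lE. Qed.

Lemma residue_representatives : exists r : 'I_q -> K,
  [/\ forall k, 0 <= val (r k),
      forall x, 0 <= val x -> exists k, 1 <= val (x - r k)%R &
      forall x k l, 1 <= val (x - r k)%R -> 1 <= val (x - r l)%R -> k = l].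
Proof.
case: lfP => _ _ _ /card_esym /card_set_bijP [f [fF fI fS]].
have coset (k : 'I_q) : {a | 0 <= val a /\ f k = [set x | 0 < val (x - a)%R]}.
  by apply: cid; case: (fF _ (ltn_ord k)) => a aO <-; exists a.
exists (fun k => projT1 (coset k)); split=> [k|x xO|x k l].
- by case: (coset k) => a [].
- have [|k /= kq fk] := fS [set y | 0 < val (y - x)%R]; first by exists x.
  exists (Ordinal kq); case: (coset _) => a [_ /= fa]; apply: val_ge1.
  suff : [set x | 0 < val (x - a)%R] x by [].
  by rewrite -fa fk /= subrr val0 ltey.
case: (coset k) => a /= [_ fa]; case: (coset l) => b /= [_ fb] xa xb.
apply: val_inj; apply: fI; rewrite ?inE /= ?ltn_ord // fa fb.
have ab : 1 <= val (a - b)%R.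
  by have := le_valB vP xb xa; rewrite opprB addrC addrA subrK.
apply/seteqP; split=> y /= /val_ge1 ya; apply: (@lt_le_trans _ _ 1); rewrite ?lte01 //.
  by have := le_valD vP ya ab; rewrite addrA subrK.
by have := le_valB vP ya ab; rewrite opprB addrA subrK.
Qed.

Lemma residue_card_gt1 : (1 < q)%N.
Proof.
have [r [_ rO rI]] := residue_representatives.
have [k k0] := rO 0%R ltac:(by rewrite val0 leey).
have [l l1] := rO 1%R ltac:(by rewrite (val_one vP)).
have kl : k != l.
  apply/eqP => kl; have := le_valB vP l1 k0.
  by rewrite kl sub0r opprK subrK (val_one vP) lee_fin ler10.
rewrite ltnNge; apply: contra kl => q1; apply/eqP; apply: val_inj => /=.
have := leq_trans (ltn_ord k) q1; have := leq_trans (ltn_ord l) q1.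
by rewrite !ltnS !leqn0 => /eqP -> /eqP ->.
Qed.

(** One step of the expansion in powers of a uniformizer p: the m-th digits are
    p^m times representatives of the residue classes. *)
Lemma digit_representatives : exists r : int -> 'I_q -> K,
  [/\ forall m k, (m%:~R)%:E <= val (r m k),
      forall m x, (m%:~R)%:E <= val x -> exists k, ((m + 1)%:~R)%:E <= val (x - r m k)%R &
      forall m x k l, ((m + 1)%:~R)%:E <= val (x - r m k)%R ->
        ((m + 1)%:~R)%:E <= val (x - r m l)%R -> k = l].
Proof.
have [r [r0 rO rI]] := residue_representatives.
have [p p0 vp] := uniformizer_exists.
have pK m x : (x = p ^ m * (p ^ (- m) * x))%R.
  by rewrite mulrA -expfzDr // subrr expr0z mul1r.
exists (fun m k => p ^ m * r k)%R; split=> [m k|m x|m x k l].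
- by rewrite -[m in leLHS]addr0 le_val_exprzM // r0.
- rewrite (pK m x) -{1}[m]addr0 le_val_exprzM // => /rO[k xk].
  by exists k; rewrite -mulrBr le_val_exprzM //.
by rewrite (pK m x) -!mulrBr !le_val_exprzM //; exact: rI.
Qed.

(** * Haar measure *)

Section Measure.
Context (mu : {measure set (borelK val) -> \bar R}) (muP : normalized_haar mu).

Definition val_ball (a : K) (m : int) : set K := [set x | (m%:~R)%:E <= val (x - a)%R].

Lemma val_open_ball a m : val_open val (val_ball a m).
Proof.
move=> x /= xa; exists m%:~R => y /= yx.
by have := le_valD vP yx xa; rewrite addrA subrK.
Qed.

Lemma measurable_ball a m : measurable (val_ball a m : set (borelK val)).
Proof. by apply: sub_sigma_algebra; exact: val_open_ball. Qed.

Lemma measure_split d (T : measurableType d) (m : {measure set T -> \bar R})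
    (S : set T) (F : 'I_q -> set T) c :
  (forall k, measurable (F k)) -> (forall x, S x <-> exists k, F k x) ->
  (forall x k l, F k x -> F l x -> k = l) -> (forall k, m (F k) = c) ->
  m S = q%:R%:E * c.
Proof.
move=> mF SF Fdisj mFc.
have -> : S = \big[setU/set0]_(k < q) F k.
  rewrite -bigcup_seq; apply/seteqP; split=> x.
    by move=> /SF[k Fk]; exists k => //=; exact: mem_index_enum.
  by move=> [k _ Fk]; apply/SF; exists k.
rewrite measure_bigsetU_ord //; last by move=> k l _ _ [x [Fk Fl]]; exact: Fdisj Fk Fl.
rewrite (eq_bigr (fun=> c)) => [|k _]; last exact: mFc.
by rewrite mule_natl sumr_const card_ord.
Qed.

(** The ball of exponent n splits into q translates of the ball of exponent
    n + 1, which all have the same measure. *)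
Lemma haar_ball a (n : nat) : mu (val_ball a n%:Z) = (q%:R ^- n)%:E.
Proof.
have [r [rm rO rI]] := digit_representatives.
have q0 : (q%:R != 0 :> R)%R by rewrite pnatr_eq0 -lt0n (ltn_trans _ residue_card_gt1).
have tr b (m : int) : mu (val_ball b m) = mu (val_ball 0%R m).
  case: muP => _ /(_ b _ (measurable_ball 0%R m)) <-; congr (mu _).
  apply/seteqP; split=> x /=.
    by move=> xb; exists (x - b)%R; rewrite /val_ball /= ?subr0 // addrC subrK.
  by move=> [y]; rewrite /val_ball /= subr0 => yb <-; rewrite addrC addKr.
rewrite tr; elim: n => [|n IH].
  rewrite expr0 invr1; case: muP => <- _; congr (mu _).
  by apply/seteqP; split=> x; rewrite /val_ball /= subr0.
have : mu (val_ball 0%R n%:Z) = q%:R%:E * mu (val_ball 0%R n.+1%:Z).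
  apply: (@measure_split _ (borelK val) mu (val_ball 0%R n%:Z)
    (fun k => val_ball (r n%:Z k) n.+1%:Z)).
  - by move=> k; exact: measurable_ball.
  - move=> x; rewrite /val_ball /= subr0 -addn1 PoszD; split; first exact: rO.
    move=> [k xk]; rewrite -(subrK (r n%:Z k) x); apply: (le_valD vP) => //.
    by apply: le_trans xk; rewrite lee_fin ler_int lerDl.
  - by move=> x k l; rewrite /val_ball /= -addn1 PoszD; exact: rI.
  - by move=> k; rewrite tr.
rewrite IH; case: (mu (val_ball 0%R n.+1%:Z)) => [x| |].
- rewrite -EFinM => -[] E; congr EFin; apply: (mulfI q0).
  by rewrite -E exprS invfM mulVKf.
- by rewrite mulry gtr0_sg ?mul1e // ltr0n (ltn_trans _ residue_card_gt1).
- by rewrite mulrNy gtr0_sg ?mul1e // ltr0n (ltn_trans _ residue_card_gt1).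
Qed.

Lemma measurable_set1_0 : measurable ([set 0%R] : set (borelK val)).
Proof.
rewrite -[X in measurable X]setCK; apply: measurableC.
apply: sub_sigma_algebra => x /= x0; have [m vx] := val_int (introN eqP x0).
exists (m + 1)%:~R => y /= yx y0; move: yx.
by rewrite y0 sub0r (valN vP) vx lee_fin ler_int gerDl.
Qed.

(** A point lies in balls of measure q^-n for all n. *)
Lemma haar_set1_0 : mu [set 0%R] = 0.
Proof.
have le n : mu [set 0%R] <= (q%:R ^- n)%:E.
  rewrite -(haar_ball 0%R); apply: le_measure; rewrite ?inE.
  - exact: measurable_set1_0.
  - exact: measurable_ball.
  by move=> _ ->; rewrite /val_ball /= subr0 val0 leey.
apply/eqP; rewrite eq_le measure_ge0 andbT leNgt; apply/negP.
case: (mu _) le => [x le x0| |] //; last by move=> /(_ 0%N); rewrite leye_eq.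
rewrite lte_fin in x0.
have xV0 : (0 < x^-1)%R by rewrite invr_gt0.
have := archi_boundP (ltW xV0).
set n := Num.bound _ => xn.
have := le n; rewrite lee_fin leNgt => /negP; apply.
rewrite -[x]invrK ltf_pV2 ?posrE ?invr_gt0 ?exprn_gt0 ?ltr0n ?(ltn_trans _ residue_card_gt1) //.
apply: lt_trans xn _; rewrite -natrX ltr_nat; apply: ltn_expl; exact: residue_card_gt1.
Qed.

Section Lattice.
Context (d : nat) (nu : {measure set (borelV val d) -> \bar R}).
Context (nuP : product_power mu nu).

(** For G invertible, the translate by y of the lattice spanned by the columns of
    G^-1 diag(pi^a).  The form with G rather than its inverse makes membership
    a condition on each coordinate separately. *)
Definition lattice_coset (G : 'M[K]_d) (y : 'cV[K]_d) (a : 'I_d -> int) : set 'cV[K]_d :=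
  [set z | forall i, ((a i)%:~R)%:E <= val ((G *m (z - y)) i ord0)%R].

(** The radius r makes every term G i j * x j of valuation at least a i. *)
Lemma vec_open_lattice_coset G y a : vec_open val (lattice_coset G y a).
Proof.
move=> x xB.
pose r : R := \big[Num.max/0%R]_(p : 'I_d * 'I_d) ((a p.1)%:~R - fine (val (G p.1 p.2)))%R.
exists r => z /= zx i.
have -> : (z - y = (x - y) + (z - x))%R by rewrite [RHS]addrC addrA subrK.
rewrite mulmxDr mxE; apply: (le_valD vP); first exact: xB.
rewrite mxE; apply: (le_val_sum vP) => j _; rewrite valM.
have [->|G0] := eqVneq (G i j) 0%R.
  by rewrite val0 addye ?leey // (gt_eqF (lt_le_trans (ltNyr r) _)) // !mxE.
have Gf := val_fin_num vP G0; rewrite -(fineK Gf).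
apply: (@le_trans _ _ ((fine (val (G i j)))%:E + r%:E)).
  rewrite -EFinD lee_fin -lerBlDl.
  by apply: (bigmax_sup (i, j)).
by rewrite leeD2l //; have := zx j; rewrite !mxE.
Qed.

Lemma measurable_lattice_coset G y a : measurable (lattice_coset G y a : set (borelV val d)).
Proof. by apply: sub_sigma_algebra; exact: vec_open_lattice_coset. Qed.

Context (p : K) (p0 : p != 0%R) (vp : val p = 1).
Context (v : 'I_d -> int) (U : 'M[K]_d) (iuU : integral_unitmx val U).

Let D := diag_mx (\row_i (p ^ v i)%R).
Let G := invmx (D *m U).

Lemma scale_unit : D *m U \in unitmx.
Proof.
case: iuU => Uu _ _; rewrite unitmx_mul Uu andbT unitmxE det_diag unitfE.
by apply/prodf_neq0 => i _; rewrite mxE expfz_neq0.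
Qed.

(** U and its inverse preserve the vectors all of whose entries have valuation at
    least n, so for constant a only the scaling by D matters. *)
Lemma lattice_coset_const y (n : int) :
  lattice_coset G y (fun=> n) = [set z | forall i, val_ball (y i ord0) (v i + n) (z i ord0)].
Proof.
case: iuU => Uu iU iU'.
have wE (w : 'cV[K]_d) i : (p ^ v i * (U *m (G *m w)) i ord0 = w i ord0)%R.
  have {2}<- : D *m U *m (G *m w) = w by rewrite mulKVmx ?scale_unit.
  by rewrite -[D *m U *m _]mulmxA mul_diag_mx [RHS]mxE; congr (_ * _)%R; rewrite mxE.
have zyE (z : 'cV[K]_d) i : (z i ord0 - y i ord0 = (z - y) i ord0)%R by rewrite !mxE.
apply/seteqP; split=> z /= zP i.
  have := entries_ge_mulmx vP iU zP i; rewrite -(le_val_exprzM _ (v i) _ p0 vp) wE.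
  by rewrite /val_ball /= zyE.
have -> : (G *m (z - y) = invmx U *m (U *m (G *m (z - y))))%R by rewrite mulKmx.
apply: (entries_ge_mulmx vP iU') => j; rewrite -(le_val_exprzM _ (v j) _ p0 vp) wE.
by rewrite -zyE; exact: zP.
Qed.

(** Translation invariance of nu is known only on products of balls, that is, by
    [lattice_coset_const], for constant a.  Every coset is cut down to such
    products: raising a single exponent a i by one splits it into q cosets, and
    a large common exponent n is reached after finitely many steps.  The
    induction is on the number k of steps left. *)
Lemma haar_lattice_coset y a : nu (lattice_coset G y a) = (q%:R ^ (- \sum_i (v i + a i)))%:E.
Proof.
have q0 : (q%:R != 0 :> R)%R by rewrite pnatr_eq0 -lt0n (ltn_trans _ residue_card_gt1).
have [r [rm rO rI]] := digit_representatives.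
(* n bounds all a i, and v i + n >= 0 makes haar_ball applicable *)
pose n : int := (\sum_i (`|a i| + `|v i|))%R.
have n_ge i : (a i <= n)%R /\ (0 <= v i + n)%R.
  have : (`|a i| + `|v i| <= n)%R.
    by rewrite /n (bigD1 i) //= lerDl sumr_ge0 // => j _; rewrite addr_ge0.
  have := ler_norm (a i); have := ler_norm (- v i); rewrite normrN.
  have := normr_ge0 (a i); have := normr_ge0 (v i); by split; lra.
have : forall i, (a i <= n)%R by move=> i; case: (n_ge i).
have {n_ge} : forall i, (0 <= v i + n)%R by move=> i; case: (n_ge i).
move: n => n vn an.
have [k] : exists k : nat, (\sum_i (n - a i))%R = k%:Z.
  have : (0 <= \sum_i (n - a i))%R by rewrite sumr_ge0 // => i _; rewrite subr_ge0.
  by case: (\sum_i _)%R => k // _; exists k.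
elim: k a y an => [|k IH] a y an sum_a.
  have {sum_a} aE i : a i = n.
    apply/eqP; rewrite eq_sym -subr_eq0; apply/eqP.
    apply: (psumr_eq0P _ sum_a) => // j _; by rewrite subr_ge0.
  have -> : a = fun=> n by apply/funext.
  rewrite lattice_coset_const (@nuP (fun i => val_ball (y i ord0) (v i + n))); last first.
    by move=> i; exact: measurable_ball.
  rewrite (eq_bigr (fun i => (q%:R ^ (- (v i + n)))%:E)) => [|i _].
    rewrite prodEFin; congr EFin; rewrite raddf_sum /=.
    by rewrite (big_morph _ (fun x y => expfzDr x y q0) (expr0z _)).
  have := vn i; case: (v i + n)%R => // m _.
  by rewrite haar_ball exprnN.
have [i ai] : exists i, (a i < n)%R.
  apply/not_existsP => a_ge; move: sum_a.
  rewrite big1 // => i _; apply/eqP; rewrite subr_eq0 eq_le an andbT.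
  by rewrite leNgt; apply/negP/a_ge.
pose a' j := (a j + (j == i)%:R)%R.
have sum_a' f : (\sum_j (f j + a' j) = 1 + \sum_j (f j + a j))%R.
  rewrite [RHS]addrC; under eq_bigr do rewrite /a' addrA.
  rewrite big_split /=; congr (_ + _)%R.
  by rewrite (bigD1 i) //= eqxx big1 ?addr0 // => j /negPf ->.
(* the centers of the q pieces: y moved by a digit in the coordinate (G z)_i *)
pose y' l := (y + D *m U *m (r (a i) l *: delta_mx i ord0))%R.
have GE l z j : ((G *m (z - y' l)) j ord0 =
    (G *m (z - y)) j ord0 - (if j == i then r (a i) l else 0))%R.
  rewrite /y' opprD addrA mulmxBr mulKmx ?scale_unit // mxE; congr (_ + _)%R.
  by rewrite !mxE eqxx andbT; case: eqP => _; rewrite ?mulr1 ?mulr0.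
have a'i : a' i = (a i + 1)%R by rewrite /a' eqxx.
have a'j j : j != i -> a' j = a j by rewrite /a' => /negPf ->; rewrite addr0.
rewrite (@measure_split _ (borelV val d) nu (lattice_coset G y a) (fun l => lattice_coset G (y' l) a')
   (q%:R ^ (- \sum_i (v i + a' i)))%:E).
- by rewrite -EFinM sum_a' opprD -{1}[q%:R]expr1z -expfzDr // addNKr.
- by move=> l; exact: measurable_lattice_coset.
- move=> z; split=> [zB|[l zB] j].
    have [l zl] := rO _ _ (zB i); exists l => j; rewrite GE.
    have [->|ji] := eqVneq j i; first by rewrite a'i.
    by rewrite subr0 a'j.
  have := zB j; rewrite GE; have [->|ji] := eqVneq j i; last by rewrite subr0 a'j.
  rewrite a'i => zi; rewrite -(subrK (r (a i) l) ((G *m (z - y)) i ord0)).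
  by apply: (le_valD vP) => //; apply: le_trans zi; rewrite lee_fin ler_int lerDl.
- move=> z l m /(_ i) + /(_ i); rewrite !GE eqxx a'i; exact: rI.
move=> l; apply: IH => [j|].
  have [->|ji] := eqVneq j i; first by rewrite a'i lezD1.
  by rewrite a'j.
have sumE f : (\sum_j (n - f j) = - \sum_j (- n + f j))%R.
  by rewrite -sumrN; apply: eq_bigr => j _; rewrite opprD opprK.
by rewrite sumE (sum_a' (fun=> - n)%R) opprD -sumE sum_a intS addKr.
Qed.

Lemma measurable_hyperplane i :
  measurable ([set z : 'cV[K]_d | z i ord0 = 0%R] : set (borelV val d)).
Proof.
rewrite -[X in measurable X]setCK; apply: measurableC.
apply: sub_sigma_algebra => x /= x0; have [m vx] := val_int (introN eqP x0).
exists (m + 1)%:~R => y /= yx y0; have := yx i.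
by rewrite y0 sub0r (valN vP) vx lee_fin ler_int gerDl.
Qed.

(** The other coordinates range over K, possibly of infinite measure, but
    0 * +oo = 0 in the product. *)
Lemma haar_hyperplane i : nu [set z : 'cV[K]_d | z i ord0 = 0%R] = 0.
Proof.
pose B (j : 'I_d) : set (borelK val) := if j == i then [set 0%R] else setT.
have -> : [set z : 'cV[K]_d | z i ord0 = 0%R] =
    [set z : 'cV[K]_d | forall j, B j (z j ord0)].
  apply/seteqP; split=> z /= zB; last by have := zB i; rewrite /B eqxx.
  by move=> j; rewrite /B; case: eqP => [->|].
rewrite nuP => [|j]; last first.
  by rewrite /B; case: eqP => _; [exact: measurable_set1_0|exact: measurableT].
by rewrite (bigD1 i) //= {1}/B eqxx haar_set1_0 mul0e.
Qed.

End Lattice.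

Lemma lattice_eq_coset d (A : 'M[K]_d) L : representative val A L ->
  L = lattice_coset (invmx A) 0%R (fun=> 0%R).
Proof.
move=> rA; apply/seteqP; split=> z.
  by move=> /(representativeP _ rA) zi i; rewrite subr0; exact: zi.
move=> zB; apply/(representativeP _ rA) => i j.
rewrite ord1 -[z]subr0; exact: zB.
Qed.

(** * The Gaussian measure of an orthant *)

Section Gaussian.
Context (d : nat) (nu : {measure set (borelV val d) -> \bar R}).
Context (nuP : product_power mu nu) (L : set 'cV[K]_d) (A : 'M[K]_d).
Context (rA : representative val A L).

(** Both sides of the tail formula are expressed by the same exponent e, computed
    from the valuations tau of the Smith form of diag(pi^v)^-1 A. *)
Lemma gaussian_orthant (v : 'I_d -> int) : exists e : int,
  gaussian nu L [set z | forall i, ((v i)%:~R)%:E <= val (z i ord0)] = (q%:R ^ e)%:E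
  /\ \big[maxe/-oo]_(I : {set 'I_d})
       ((\sum_(i in I) (v i)%:~R)%R%:E - entropy_mx val A I) = (- e%:~R)%R%:E.
Proof.
have [p p0 vp] := uniformizer_exists.
have q0 : (q%:R != 0 :> R)%R by rewrite pnatr_eq0 -lt0n (ltn_trans _ residue_card_gt1).
have Au := proj1 rA.
pose s : 'rV[K]_d := \row_i (p ^ v i)%R.
have Du : diag_mx s \in unitmx.
  by rewrite unitmxE det_diag unitfE; apply/prodf_neq0 => i _; rewrite mxE expfz_neq0.
have [U [W [t [iuU iuW ME]]]] := smith_form vP (invmx (diag_mx s) *m A).
have AE : A = diag_mx s *m (U *m diag_mx t *m W) by rewrite -ME mulKVmx.
have [Uu _ _] := iuU; have [Wu iW iW'] := iuW.
have tau_ex i : {m : int | val (t ord0 i) = (m%:~R)%:E}.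
  apply/cid/val_int; have : diag_mx t \in unitmx.
    have : U *m diag_mx t *m W \in unitmx by rewrite -ME unitmx_mul unitmx_inv Du.
    by rewrite !unitmx_mul Uu Wu andbT.
  by rewrite unitmxE det_diag unitfE => /prodf_neq0; apply.
pose tau i := projT1 (tau_ex i).
have tE i : val (t ord0 i) = ((tau i)%:~R)%:E by rewrite /tau; case: (tau_ex i).
(* in the coordinates given by diag(s) U, the lattice L is a box *)
have LE : L = lattice_coset (invmx (diag_mx s *m U)) 0%R tau.
  have GE z : invmx (diag_mx s *m U) *m z = diag_mx t *m (W *m (invmx A *m z)).
    have {1}-> : z = diag_mx s *m U *m (diag_mx t *m (W *m (invmx A *m z))).
      by rewrite -[LHS](mulKVmx Au) {1}AE -!mulmxA.
    by rewrite mulKmx // unitmx_mul Du.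
  have iff0 z i : (((tau i)%:~R)%:E <= val ((diag_mx t *m z : 'cV_d) i ord0)) =
      (0 <= val (z i ord0)).
    by rewrite mul_diag_mx mxE (valM (t _ _)) tE -{1}[(tau i)%:~R%:E]adde0 leeD2lE.
  apply/seteqP; split=> z.
    move=> /(representativeP _ rA) zi i; rewrite subr0 GE iff0.
    exact: (integral_mulmx vP).
  move=> zB; apply/(representativeP _ rA).
  rewrite -[invmx A *m z](mulKmx Wu); apply: (integral_mulmx vP) => // i j.
  by rewrite ord1 -iff0 -GE -[z]subr0; exact: zB.
exists (\sum_i Num.min 0 (tau i))%R; split.
  set B := (X in gaussian _ _ X).
  have -> : B =
      lattice_coset (invmx (diag_mx s *m U)) 0%R (fun=> 0%R).
    rewrite lattice_coset_const //; apply/seteqP; split=> z zP i; have := zP i;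
      by rewrite /val_ball /mkset mxE addr0 subr0.
  have LB : L `&` lattice_coset (invmx (diag_mx s *m U)) 0%R (fun=> 0%R) =
      lattice_coset (invmx (diag_mx s *m U)) 0%R (fun i => Num.max 0 (tau i))%R.
    rewrite LE; apply/seteqP; split=> z.
      by move=> [z1 z2] i; rewrite /Num.max; case: ifP.
    move=> zB; split=> i; apply: le_trans (zB i); rewrite lee_fin ler_int le_max lexx ?orbT //.
  rewrite /gaussian [X in nu X]LB LE !haar_lattice_coset //.
  rewrite inver (negPf (expfz_neq0 _ q0)) -EFinM invr_expz -expfzDr //.
  congr (_ ^ _)%:E; rewrite opprK addrC -sumrB; apply: eq_bigr => i _.
  by rewrite opprD addrACA subrr add0r; case: (leP 0%R (tau i)) => _; rewrite ?subrr ?subr0.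
rewrite (tropical_entropy vP _ tE iuU iuW Au AE) => [|i]; last by rewrite mxE val_exprz.
congr (- _)%:E; rewrite rmorph_sum /=; apply: eq_bigr => i _.
have [t0|t0] := leP 0%R (tau i); first by rewrite min_l // ler0z.
by rewrite min_r // lerz0 ltW.
Qed.

End Gaussian.
End Measure.

End LocalField.

(** * The theorem *)

Lemma logqe_exprz (R : realType) (q : nat) (e : int) : (1 < q)%N ->
  logqe q ((q%:R : R) ^ e)%:E = (e%:~R : R)%:E.
Proof.
move=> q1; have q0 : (0 < q%:R :> R)%R by rewrite ltr0n (ltn_trans _ q1).
have lnX n : (ln ((q%:R : R) ^+ n) = n%:R * ln q%:R)%R.
  by rewrite lnXn // mulr_natl.
have lnq : (ln (q%:R : R) != 0)%R by rewrite gt_eqF // ln_gt0 // ltr1n.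
have lnE : (ln ((q%:R : R) ^ e) = e%:~R * ln q%:R)%R.
  case: e => n; first exact: lnX.
  by rewrite NegzE -exprnN lnV ?posrE ?exprn_gt0 // lnX mulrNz mulNr.
rewrite /logqe /lne leNgt exprz_gt0 //= lnE inver (negPf lnq) -EFinM mulfK //.
Qed.

Theorem theorem1p3 (R : realType) :
  (forall (K : fieldType) (val : K -> \bar R) (q d : nat) (L : set 'cV[K]_d),
     local_field val q -> (0 < d)%N -> lattice val L ->
     (* (a) *)
     (forall (mu : {measure set (borelK val) -> \bar R})
             (nu : {measure set (borelV val d) -> \bar R})
             (disp : measure_display) (Omega : measurableType disp)
             (P : probability Omega R) (X : {RV P >-> borelV val d}),
        normalized_haar mu -> product_power mu nu ->
        (forall B : set (borelV val d), measurable B ->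
           distribution P X B = gaussian nu L B) ->
        {ae P, forall w, forall i, exists m : int,
           val ((X w : 'cV[K]_d) i ord0) = (m%:~R)%:E} /\
        (forall v : 'I_d -> int,
           - logqe q (P [set w | forall i,
                          ((v i)%:~R)%:E <= val ((X w : 'cV[K]_d) i ord0)])
           = \big[maxe/-oo]_(I : {set 'I_d})
               ((\sum_(i in I) (v i)%:~R)%R%:E - entropy val L I))) /\
     (* (b) *)
     supermodular (entropy val L)) /\
  (* (c) *)
  (forall (K : fieldType) (val : K -> \bar R) (d : nat) (L : set 'cV[K]_d),
     valuation val -> (0 < d)%N -> lattice val L ->
     (forall (A B : 'M[K]_d) (I : {set 'I_d}),
        representative val A L -> representative val B L ->
        entropy_mx val A I = entropy_mx val B I) /\
     supermodular (entropy val L)).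
Proof.
have sup (K : fieldType) (val : K -> \bar R) (d : nat) (L : set 'cV[K]_d) :
    valuation val -> lattice val L -> supermodular (entropy val L).
  move=> vP [A rA]; rewrite (entropyE vP rA).
  exact: (entropy_mx_supermodular vP (proj1 rA)).
split=> [K val q d L lfP _ lL|K val d L vP _ lL]; last first.
  split; last exact: sup.
  move=> A B I rA rB; exact: (entropy_mx_representative vP I rA rB).
have vP : valuation val by case: lfP.
split; last exact: sup.
move=> mu nu disp Omega P X muP nuP PX; split.
  apply: filter_forall => i.
  pose Z : set 'cV[K]_d := [set z | z i ord0 = 0%R].
  have mZ : measurable (Z : set (borelV val d)) by exact: (measurable_hyperplane lfP).
  exists (X @^-1` Z); split.
  - by rewrite -[X in measurable X]setTI; exact: measurable_funPT.
  - have := PX Z mZ; rewrite /distribution /pushforward => ->.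
    have [A rA] := lL; rewrite /gaussian.
    suff -> : nu (L `&` Z) = 0 by rewrite mul0e.
    apply/eqP; rewrite eq_le measure_ge0 andbT -(haar_hyperplane lfP muP nuP i).
    apply: le_measure; rewrite ?inE //.
    by apply: measurableI => //; rewrite (lattice_eq_coset rA); exact: (measurable_lattice_coset lfP).
  move=> w /= Xw; apply/eqP; apply/negPn/negP => X0; apply: Xw.
  exact: (val_int lfP X0).
move=> v; have [A rA] := lL; rewrite (entropyE vP rA).
have [e [ge ->]] := gaussian_orthant lfP muP nuP rA v.
rewrite EFinN -(logqe_exprz _ e (residue_card_gt1 lfP)) -ge -PX //.
set B := (X in measurable X); have -> : B = lattice_coset val 1%:M 0%R v.
  by apply/seteqP; split=> z zP i; have := zP i; rewrite mul1mx subr0.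
exact: (measurable_lattice_coset lfP).
Qed.
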